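(* Let $V:f=0$ be a reduced plane curve of degree $d$ in $\mathbb{P}^2$, where $f\in\mathbb{C}[x,y,z]$ is homogeneous of degree $d$, essentially involves the three variables, and has Waring rank $5$. Suppose that $f=\ell_1^d+\cdots+\ell_5^d$ is a Waring decomposition $(\mathcal{D})$ of $f$ such that the associated line arrangement $\mathcal{A}_{\mathcal{D}}:\ell_1\cdots\ell_5=0$ has $n_3=1$ triple point (and $n_2=7$ double points). Then, up to a linear change of coordinates, $$f=x^d+y^d+z^d+(a_1x+b_1y)^d+(a_2x+b_2y+c_2z)^d$$ with $(a_1,b_1,a_2,b_2,c_2)\in(\mathbb{C}^* )^5$ and $a_2b_1\neq a_1b_2$. If, moreover, the additional conditions $$b_2^{d-1}+a_1(a_1b_2-a_2b_1)^{d-1}=0,\qquad (-1)^db_1b_2^{d-1}+a_1a_2^{d-1}=0,\qquad c_2^d+1=0$$ hold, then the curve $V:f=0$ has a singularity of type $A_{2d-3}$ located at the point $p=(-b_2:a_2:0)$.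
   Context: The Waring rank of a homogeneous polynomial $f$ of degree $d$ over $\mathbb{C}$ is the minimal $r$ such that $f=\ell_1^d+\cdots+\ell_r^d$ with linear forms $\ell_j$; such an expression with $r$ minimal is called a Waring decomposition. The form $f$ essentially involves the variables $x,y,z$ if it cannot be written, after a linear change of coordinates, as a polynomial in fewer than three variables; equivalently the $\ell_j$ span the space of all linear forms. For a line arrangement, $n_j$ is the number of points lying on exactly $j$ lines of the arrangement. A plane curve singularity is of type $A_m$ if it is analytically isomorphic to $v^2+w^{m+1}=0$ at the origin of $\mathbb{C}^2$. *)

(* Defs.v *)
From HB Require Import structures.
From mathcomp Require Import all_boot all_order all_algebra.
From mathcomp Require Import complex mpoly.
From mathcomp Require Import boolp classical_sets functions cardinality.
From mathcomp Require Import topology normedtype derive.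

Set Implicit Arguments.
Unset Strict Implicit.
Unset Printing Implicit Defensive.

Import Order.TTheory GRing.Theory Num.Theory.
Import numFieldNormedType.Exports.
Local Open Scope classical_set_scope.
Local Open Scope card_scope.
Local Open Scope ring_scope.

Definition lin_subst (C : fieldType) (A : 'M[C]_3) (f : {mpoly C[3]}) :
    {mpoly C[3]} :=
  f \mPo [tuple \sum_(j < 3) A i j *: 'X_j | i < 3].

(* [mwiden g] is the polynomial g in the first two of the three variables. *)
Definition essentially_three_variables (C : fieldType) (f : {mpoly C[3]}) :
    Prop :=
  ~ exists2 A : 'M[C]_3, A \in unitmx
      & exists g : {mpoly C[2]}, lin_subst A f = mwiden g.

(* No square of a nonconstant polynomial divides f; in particular f != 0. *)
Definition reduced (C : fieldType) (f : {mpoly C[3]}) : Prop :=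
  forall g h : {mpoly C[3]}, f = g ^+ 2 * h -> (msize g <= 1)%N.

Definition sum_of_powers (C : fieldType) (d r : nat)
    (l : 'I_r -> {mpoly C[3]}) (f : {mpoly C[3]}) : Prop :=
  (forall i, l i \is 1.-homog) /\ f = \sum_(i < r) l i ^+ d.

Definition waring_rank (C : fieldType) (d r : nat) (f : {mpoly C[3]}) : Prop :=
  (exists l : 'I_r -> {mpoly C[3]}, sum_of_powers d l f) /\
  forall (s : nat) (l : 'I_s -> {mpoly C[3]}),
    sum_of_powers d l f -> (r <= s)%N.

Definition waring_decomposition (C : fieldType) (d r : nat)
    (l : 'I_r -> {mpoly C[3]}) (f : {mpoly C[3]}) : Prop :=
  sum_of_powers d l f /\ waring_rank d r f.

Definition proj_plane (C : fieldType) : Type :=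
  {U : {vspace 'rV[C]_3} | \dim U == 1%N}.

Definition proj_zeros (C : fieldType) (f : {mpoly C[3]}) :
    set (proj_plane C) :=
  [set P : proj_plane C | forall v : 'rV[C]_3, v \in sval P -> f.@[v 0] = 0].

(* The set of lines, so that proportional linear forms give the same line. *)
Definition line_arrangement (C : fieldType) (r : nat)
    (l : 'I_r -> {mpoly C[3]}) : set (set (proj_plane C)) :=
  range (fun i => proj_zeros (l i)).

Definition points_of_multiplicity (C : fieldType)
    (A : set (set (proj_plane C))) (j : nat) : set (proj_plane C) :=
  [set P | [set L | A L /\ L P] #= `I_j].

Definition number_of_points (C : fieldType) (A : set (set (proj_plane C)))
    (j n : nat) : Prop :=
  points_of_multiplicity A j #= `I_n.

(* Complex (Frechet) differentiability on a neighbourhood of p. *)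
Definition holomorphic_near (C : numFieldType) (V W : normedModType C)
    (f : V -> W) (p : V) : Prop :=
  \forall x \near p, differentiable f x.

(* The curve germs (g = 0, p) and (h = 0, q) correspond under a germ of
   biholomorphism phi of C^2 with inverse psi, as germs of hypersurfaces: the
   equations g and h \o phi agree up to an invertible holomorphic factor. *)
Definition analytically_isomorphic (C : numFieldType)
    (g : C * C -> C) (p : C * C) (h : C * C -> C) (q : C * C) : Prop :=
  exists phi psi : C * C -> C * C, exists u : C * C -> C,
    [/\ phi p = q /\ psi q = p,
        holomorphic_near phi p /\ holomorphic_near psi q,
        (\forall x \near p, psi (phi x) = x) /\
          (\forall y \near q, phi (psi y) = y),
        holomorphic_near u p /\ u p != 0
      & \forall x \near p, g x = u x * h (phi x)].

(* f restricted to the affine chart x_k = 1, the two remaining homogeneous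
   coordinates being taken in increasing order of their indices. *)
Definition dehomogenize (C : fieldType) (f : {mpoly C[3]}) (k : 'I_3)
    (q : C * C) : C :=
  f.@[fun i => if unlift k i is Some j
               then (if j == ord0 then q.1 else q.2) else 1].

Definition affine_point (C : fieldType) (v : 'rV[C]_3) (k : 'I_3) : C * C :=
  (v 0 (lift k ord0) / v 0 k, v 0 (lift k ord_max) / v 0 k).

(* v is a vector of homogeneous coordinates of the point; the choice of the
   standard chart x_k = 1 containing it is immaterial, since two charts differ
   by a biholomorphism and the two equations by an invertible factor. *)
Definition singularity_of_type_A (C : numFieldType) (m : nat)
    (f : {mpoly C[3]}) (v : 'rV[C]_3) : Prop :=
  (0 < m)%N /\
  exists2 k : 'I_3, v 0 k != 0
    & analytically_isomorphic (dehomogenize f k) (affine_point v k)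
        (fun y => y.1 ^+ 2 + y.2 ^+ m.+1) (0, 0).

(* Main.v *)
Require Import Defs.
From HB Require Import structures.
From mathcomp Require Import all_boot all_order all_algebra.
From mathcomp Require Import complex mpoly.
From mathcomp Require Import boolp classical_sets functions cardinality.
From mathcomp Require Import topology normedtype prodnormedzmodule.
From mathcomp Require Import landau derive.
From mathcomp Require Import interval_inference reals.
From mathcomp Require Import ring zify.

Import Order.TTheory GRing.Theory Num.Theory.
Import numFieldNormedType.Exports.
Local Open Scope classical_set_scope.
Local Open Scope ring_scope.

Set Implicit Arguments.
Unset Strict Implicit.
Unset Printing Implicit Defensive.

(** The proof has two independent parts.

    Normal form.  Two proportional forms of a decomposition could be merged
    into one, because the field has d-th roots; as the rank is 5, the five
    linear forms define five different lines ([waring_forms_distinct]).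
    Take two of the three lines through the triple point and one line off
    it: they are the sides of a triangle, and we use them as coordinates x,
    y, z.  The third line through the triple point is then a1 x + b1 y and
    the last one is a2 x + b2 y + c2 z.  If one of a2, b2, a2 b1 - a1 b2
    vanished, three of the lines would meet in a second triple point on the
    line z = 0 ([normal_coordinates]).

    Singularity.  Put x = 1, let y0 = - a2 / b2 and w = y - y0, so that
    a2 + b2 y = b2 w.  The three conditions on the coefficients imply that
    the terms of the equation that are constant and linear in w reduce to
    a nonzero multiple of w z^(d-1), which after scaling leaves
        w^2 S(w, z) + w z^(d-1)
    for a polynomial S ([translated_equation]).  If d >= 3 then S(0, 0) <> 0
    ([second_derivative_neq0]), and the change of coordinates w' = w S(w, z)
    turns the equation, up to the factor 1 / S, into w' (w' + z^(d-1)): two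
    smooth branches with contact of order d - 1.  Completing the square gives
    v^2 + t^(2d-2), that is A_(2d-3).  If d = 2 then S is constant and a linear
    change of coordinates does the same.

    The one analytic ingredient is that (w, z) |-> (w S(w, z), z) has a
    holomorphic local inverse.  Here w S(w, z) is a polynomial in w, so over an
    algebraically closed field the equation w S(w, z) = c has solutions, and
    the sum of the reciprocals of its roots bounds the smallest one by a
    multiple of |c| ([small_root], [small_solution]).  A choice of such roots
    is holomorphic because polynomials have continuous difference quotients
    ([small_solution_inverse]). *)

(** * Difference quotients and differentiability *)

Lemma differentiable_approx (C : numFieldType) (V W : normedModType C)
    (f : V -> W) (df : {linear V -> W}) (x : V) :
    continuous df ->
    (forall e : C, 0 < e ->
       \forall y \near x, `|f y - f x - df (y - x)| <= e * `|y - x|) ->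
  differentiable f x.
Proof.
move=> df_cont approx; apply/diff_locallyP.
suff fE : f \o shift x = cst (f x) + df +o_ 0 id.
  by rewrite (diff_unique df_cont fE).
apply/eqaddoP => e e_gt0; have := approx e e_gt0.
rewrite (near_shift 0) subr0; apply: filterS => h /=.
by rewrite addrK opprD addrA.
Qed.

(** Caratheodory's description of differentiability: the increment is a linear
    form in the displacement with coefficients that are continuous at x, and
    the values of these coefficients at x are the partial derivatives. *)
Lemma differentiable_increment (C : numFieldType) (f A B : C * C -> C)
    (x : C * C) :
    {for x, continuous A} -> {for x, continuous B} ->
    (\forall y \near x, f y - f x = (y.1 - x.1) * A y + (y.2 - x.2) * B y) ->
  differentiable f x.
Proof.
move=> cA cB fx.
pose d (h : C * C) : C := h.1 * A x + h.2 * B x.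
have d_lin : linear d.
  by move=> a u v; rewrite /d /= !mulrDl scalerDr -!scalerAl addrACA.
pose dM := GRing.isLinear.Build _ _ _ _ _ d_lin.
pose dL : {linear _ -> _} := HB.pack d dM.
apply: (@differentiable_approx _ _ _ _ dL) => [h | e e_gt0].
  by apply: cvgD; apply: cvgMr_tmp; [exact: cvg_fst | exact: cvg_snd].
have e2_gt0 : 0 < e / 2 by rewrite divr_gt0.
near=> y.
have -> : f y - f x - d (y - x)
    = (y.1 - x.1) * (A y - A x) + (y.2 - x.2) * (B y - B x).
  by rewrite (near fx y) // /d /=; ring.
rewrite (le_trans (ler_normD _ _))// [e]splitr (mulrDl _ _ `|y - x|).
have comp_le : (`|(y - x).1| <= `|y - x|) && (`|(y - x).2| <= `|y - x|).
  by rewrite [`|y - x|]prod_normE !num_le_max !lexx orbT.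
have [le1 le2] := andP comp_le.
apply: lerD; rewrite normrM mulrC; apply: ler_pM => //; near: y;
  exact: cvgr_distC_le.
Unshelve. all: by end_near. Qed.

(** Difference quotients that are continuous in both end points jointly.  This
    is an algebraic substitute for continuous differentiability: it is stable
    under sums and products, hence holds for polynomials, and it gives estimates
    uniform in the two points without a mean value theorem. *)
Definition has_increments (C : numFieldType) (f : C * C -> C) : Prop :=
  exists A B : (C * C) * (C * C) -> C,
    [/\ continuous A, continuous B
      & forall x y,
        f y - f x = (y.1 - x.1) * A (x, y) + (y.2 - x.2) * B (x, y)].

Section Increments.
Variable C : numFieldType.
Implicit Types f g : C * C -> C.

Lemma has_increments_differentiable f x :
  has_increments f -> differentiable f x.
Proof.
move=> [A [B [cA cB fE]]].
have cpair : {for x, continuous (fun y : C * C => (x, y))}.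
  by apply: (@cvg_pair _ _ _ (nbhs x) (nbhs x) (nbhs x));
    [exact: cvg_cst | exact: cvg_id].
apply: (@differentiable_increment _ _ (fun y => A (x, y)) (fun y => B (x, y))).
- exact: (continuous_comp cpair (cA _)).
- exact: (continuous_comp cpair (cB _)).
- exact: (@filterE _ (nbhs x) _ _ (fE x)).
Qed.

Lemma has_increments_continuous f : has_increments f -> continuous f.
Proof.
by move=> /has_increments_differentiable df x; apply: differentiable_continuous.
Qed.

Lemma has_increments_cst (c : C) : has_increments (fun=> c).
Proof.
exists (fun=> 0), (fun=> 0); split=> [|| x y]; try exact: cst_continuous.
by rewrite !mulr0 addr0 subrr.
Qed.

Lemma has_increments_fst : has_increments (@fst C C).
Proof.
exists (fun=> 1), (fun=> 0); split=> [|| x y]; try exact: cst_continuous.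
by rewrite mulr0 addr0 mulr1.
Qed.

Lemma has_increments_snd : has_increments (@snd C C).
Proof.
exists (fun=> 0), (fun=> 1); split=> [|| x y]; try exact: cst_continuous.
by rewrite mulr0 add0r mulr1.
Qed.

Lemma has_incrementsD f g :
  has_increments f -> has_increments g -> has_increments (fun x => f x + g x).
Proof.
move=> [A [B [cA cB fE]]] [A' [B' [cA' cB' gE]]].
exists (fun p => A p + A' p), (fun p => B p + B' p).
split=> [p | p | x y].
- by apply: cvgD; [exact: cA | exact: cA'].
- by apply: cvgD; [exact: cB | exact: cB'].
- by rewrite opprD addrACA fE gE; ring.
Qed.

Lemma has_incrementsM f g :
  has_increments f -> has_increments g -> has_increments (fun x => f x * g x).
Proof.
move=> fI gI; have cf := has_increments_continuous fI.
have cg := has_increments_continuous gI.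
move: fI gI => [A [B [cA cB fE]]] [A' [B' [cA' cB' gE]]].
exists (fun p => A p * g p.2 + f p.1 * A' p).
exists (fun p => B p * g p.2 + f p.1 * B' p).
have cf1 (p : (C * C) * (C * C)) : f q.1 @[q --> p] --> f p.1.
  by apply: continuous_comp; [exact: cvg_fst | exact: cf].
have cg2 (p : (C * C) * (C * C)) : g q.2 @[q --> p] --> g p.2.
  by apply: continuous_comp; [exact: cvg_snd | exact: cg].
split=> [p | p | x y].
- by apply: cvgD; apply: cvgM;
    [exact: cA | exact: cg2 | exact: cf1 | exact: cA'].
- by apply: cvgD; apply: cvgM;
    [exact: cB | exact: cg2 | exact: cf1 | exact: cB'].
- have -> : f y * g y - f x * g x = (f y - f x) * g y + f x * (g y - g x).
    by ring.
  by rewrite fE gE /=; ring.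
Qed.

Lemma has_incrementsX f n :
  has_increments f -> has_increments (fun x => f x ^+ n).
Proof.
move=> fI; elim: n => [|n IH]; first exact: has_increments_cst.
by under eq_fun do rewrite exprS; exact: has_incrementsM.
Qed.

Lemma has_increments_sum n (f : 'I_n -> C * C -> C) :
  (forall i, has_increments (f i)) -> has_increments (fun x => \sum_i f i x).
Proof.
elim: n f => [f _|n IH f fI].
  by under eq_fun do rewrite big_ord0; exact: has_increments_cst.
under eq_fun do rewrite big_ord_recr /=.
by apply: has_incrementsD => //; exact: IH.
Qed.

End Increments.

(** * A small root of a polynomial *)

Lemma deriv_prod_XsubC_at0 (F : fieldType) (rs : seq F) :
    0 \notin rs ->
  (\prod_(r <- rs) ('X - r%:P))^`().[0]
    = - (\prod_(r <- rs) ('X - r%:P)).[0] * \sum_(r <- rs) r^-1.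
Proof.
elim: rs => [_|r rs IH]; first by rewrite !big_nil derivC horner0 mulr0.
rewrite inE negb_or eq_sym => /andP[r0 /IH{}IH].
rewrite !big_cons derivM derivXsubC mul1r hornerD !hornerM IH hornerXsubC.
by field.
Qed.

(** By the logarithmic derivative, - q'(0) / q(0) is the sum of the reciprocals
    of the roots; so the reciprocal of some root is at least the average in
    absolute value. *)
Lemma small_root (C : numClosedFieldType) (q : {poly C}) :
    q.[0] != 0 -> q^`().[0] != 0 ->
  exists2 r : C, root q r & `|q^`().[0]| * `|r| <= (size q)%:R * `|q.[0]|.
Proof.
move=> q0 dq0.
have [rs qE] := closed_field_poly_normal q.
have lc0 : lead_coef q != 0.
  by rewrite lead_coef_eq0; apply: contraNneq q0 => ->; rewrite horner0.
have root_rs r : root q r = (r \in rs).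
  by rewrite qE rootZ ?root_prod_XsubC.
have rs0 : 0 \notin rs by rewrite -root_rs.
have size_rs : size q = (size rs).+1.
  by rewrite qE size_scale // size_prod_XsubC.
have [/hasP[r r_rs le_r]|/hasPn none] :=
  boolP (has (fun r => `|q^`().[0]| * `|r| <= (size q)%:R * `|q.[0]|) rs).
  by exists r; rewrite // root_rs.
have dqE : q^`().[0] = - q.[0] * \sum_(r <- rs) r^-1.
  rewrite qE derivZ !hornerZ deriv_prod_XsubC_at0 //; ring.
have gt_rs r : r \in rs -> `|q.[0]| * `|r^-1| <= `|q^`().[0]| / (size q)%:R.
  move=> r_rs; have r0 : r != 0 by apply: contraNneq rs0 => <-.
  have := none r r_rs; rewrite -real_ltNge ?realM ?normr_real ?realn // => /ltW.
  rewrite normfV ler_pdivrMr ?normr_gt0 // mulrAC.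
  by rewrite ler_pdivlMr ?size_rs ?ltr0n // [_ * (_%:R)]mulrC.
(* If all roots were large, the sum of their reciprocals would be too small. *)
suff : `|q^`().[0]| < `|q^`().[0]| by rewrite ltxx.
rewrite {1}dqE normrM normrN.
apply: le_lt_trans (_ : `|q.[0]| * \sum_(r <- rs) `|r^-1| < _).
  by rewrite ler_wpM2l // ler_norm_sum.
rewrite mulr_sumr.
apply: le_lt_trans (_ : (size rs)%:R * (`|q^`().[0]| / (size q)%:R) < _).
  rewrite mulr_natl -iter_addr_0 -(count_predT rs) -big_const_seq.
  by rewrite [leLHS]big_seq [leRHS]big_seq; apply: ler_sum => r /gt_rs.
rewrite mulrCA gtr_pMr ?normr_gt0 // ltr_pdivrMr ?size_rs ?ltr0n //.
by rewrite mul1r ltr_nat.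
Qed.

(** * Local inverse of (w, z) |-> (w S(w, z), z) *)

Lemma near_square (T : topologicalType) (a : T) (P : T * T -> Prop) :
    (\forall p \near (a, a), P p) ->
  exists2 U : set T, nbhs a U & forall x y, U x -> U y -> P (x, y).
Proof.
move=> [[Q1 Q2] /= [nQ1 nQ2] QP]; exists (Q1 `&` Q2); first exact: filterI.
by move=> x y [Qx _] [_ Qy]; apply: QP.
Qed.

Section LocalInverse.
Variables (C : numClosedFieldType) (S : C * C -> C).
Hypotheses (S_incr : has_increments S) (S0 : S (0, 0) != 0).

(** The roots come from algebraic closedness; the bound on w, which for the
    moment stands in for continuity, comes from the derivative S (0, z) at w = 0
    of the polynomial w S(w, z) - c. *)
Lemma small_solution (N : nat) (p : C -> {poly C}) :
    (forall x, S x = (p x.2).[x.1]) -> (forall z, size (p z) <= N)%N ->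
  exists (K : C) (W : C * C -> C), 0 < K /\
    \forall x \near ((0, 0) : C * C),
      `|W x| <= K * `|x.1| /\ W x * S (W x, x.2) = x.1.
Proof.
move=> SE size_p; pose m := `|S (0, 0)| / 2.
have m_gt0 : 0 < m by rewrite divr_gt0 ?normr_gt0.
pose K := N.+1%:R / m.
have K_gt0 : 0 < K by rewrite divr_gt0.
have solve (x : C * C) : exists w : C, m <= `|S (0, x.2)| ->
    `|w| <= K * `|x.1| /\ w * S (w, x.2) = x.1.
  have [x10|x10] := eqVneq x.1 0.
    by exists 0 => _; rewrite x10 normr0 mulr0 mul0r.
  case: (boolP (m <= `|S (0, x.2)|)) => [le_m|_]; last by exists 0.
  have Sx0 : S (0, x.2) != 0 by rewrite -normr_gt0 (lt_le_trans m_gt0).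
  pose q := 'X * p x.2 - x.1%:P.
  have q0E : q.[0] = - x.1 by rewrite /q !hornerE; ring.
  have dq0E : q^`().[0] = S (0, x.2).
    by rewrite /q derivB derivM derivX derivC SE /= !hornerE; ring.
  have [|| w qw le_w] := @small_root _ q.
  - by rewrite q0E oppr_eq0.
  - by rewrite dq0E.
  exists w => _; split.
    rewrite /K mulrAC ler_pdivlMr // mulrC.
    apply: le_trans (_ : `|S (0, x.2)| * `|w| <= _).
      by rewrite ler_wpM2r.
    move: le_w; rewrite dq0E q0E normrN => /le_trans; apply.
    rewrite ler_wpM2r // ler_nat (leq_trans (size_polyD _ _)) // geq_max.
    rewrite size_polyN size_polyC x10 andbT.
    by rewrite (leq_trans (size_polyMleq _ _)) // size_polyX ltnS size_p.
  move/rootP: qw; rewrite /q SE /= !hornerE => /eqP.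
  by rewrite subr_eq0 => /eqP.
have [W WP] := choice solve.
exists K, W; split=> //.
have cont0 : S (0, x.2) @[x --> ((0, 0) : C * C)] --> S (0, 0).
  apply: (@continuous_comp _ _ _ (fun x : C * C => ((0 : C), x.2)) S (0, 0)).
    by apply: (@cvg_pair _ _ _ _ (nbhs 0) (nbhs 0));
      [exact: cvg_cst | exact: cvg_snd].
  exact: has_increments_continuous.
have : \forall x \near ((0, 0) : C * C), m < `|S (0, x.2)|.
  apply: (cvgr_norm_gt _ cont0).
  by rewrite /m ltr_pdivrMr // mulr_natr mulr2n ltrDl normr_gt0.
by apply: filterS => x /ltW; apply: WP.
Qed.

(** The increment of G : x |-> x.1 * S x has a coefficient D in the first
    coordinate with D = S (0, 0) <> 0 at the origin.  Dividing the relation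
    between the increments of G and of W by D shows first that W is Lipschitz
    near the origin, then that its own difference quotients are continuous;
    and D <> 0 also gives the local injectivity of G that identifies W as its
    inverse. *)
Lemma small_solution_inverse (K : C) (W : C * C -> C) : 0 < K ->
    (\forall x \near ((0, 0) : C * C),
       `|W x| <= K * `|x.1| /\ W x * S (W x, x.2) = x.1) ->
  [/\ W (0, 0) = 0, holomorphic_near W (0, 0)
    & \forall x \near ((0, 0) : C * C), W (x.1 * S x, x.2) = x.1].
Proof.
move=> K_gt0 W_sol.
have [A [B [cA cB SE]]] := S_incr.
have cS := has_increments_continuous S_incr.
pose Phi (x : C * C) := (W x, x.2).
(* D and E are the coefficients of the increment of x |-> x.1 * S x. *)
pose D (p : (C * C) * (C * C)) := S p.2 + p.1.1 * A p.
pose E (p : (C * C) * (C * C)) := p.1.1 * B p.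
have GE x y : y.1 * S y - x.1 * S x
    = (y.1 - x.1) * D (x, y) + (y.2 - x.2) * E (x, y).
  have -> : y.1 * S y - x.1 * S x = (y.1 - x.1) * S y + x.1 * (S y - S x).
    by ring.
  by rewrite SE /D /E /=; ring.
have c11 (p : (C * C) * (C * C)) : q.1.1 @[q --> p] --> p.1.1.
  by apply: continuous_comp; exact: cvg_fst.
have cD : continuous D.
  move=> p; apply: cvgD; last by apply: cvgM; [exact: c11 | exact: cA].
  by apply: continuous_comp; [exact: cvg_snd | exact: cS].
have cE : continuous E by move=> p; apply: cvgM; [exact: c11 | exact: cB].
pose m := `|S (0, 0)| / 2.
have m_gt0 : 0 < m by rewrite divr_gt0 ?normr_gt0.
pose M := `|E ((0, 0), (0, 0))| + 1.
have M_gt0 : 0 < M by rewrite ltr_wpDl.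
have near_DE : \forall p \near (((0, 0), (0, 0)) : (C * C) * (C * C)),
    m < `|D p| /\ `|E p| < M.
  near=> p; split; near: p.
    apply: (cvgr_norm_gt _ (cD _)); rewrite /D /= mul0r addr0.
    by rewrite /m ltr_pdivrMr // mulr_natr mulr2n ltrDl normr_gt0.
  by apply: (cvgr_norm_lt _ (cE _)); rewrite /M ltrDl.
have [U U0 UDE] := near_square near_DE.
have W0 : W (0, 0) = 0.
  have [+ _] := nbhs_singleton W_sol.
  by rewrite /= normr0 mulr0 normr_le0 => /eqP.
have cW0 : W x @[x --> ((0, 0) : C * C)] --> 0.
  apply/cvgrPdist_le => e e_gt0.
  have : \forall x \near ((0, 0) : C * C), `|x.1| <= e / K.
    by apply: (@cvgr0_norm_le _ _ _ (nbhs ((0, 0) : C * C)));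
      [exact: cvg_fst | rewrite divr_gt0].
  apply: filterS2 W_sol => x [le_W _].
  rewrite ler_pdivlMr // mulrC sub0r normrN.
  exact: le_trans.
have cPhi0 : Phi x @[x --> ((0, 0) : C * C)] --> ((0, 0) : C * C).
  by apply: (@cvg_pair _ _ _ _ (nbhs 0) (nbhs 0)) => //; exact: cvg_snd.
pose good x := U (Phi x) /\ W x * S (Phi x) = x.1.
have near_good : \forall x \near ((0, 0) : C * C), good x.
  near=> x; split; near: x; first exact: cPhi0.
  by apply: filterS W_sol => x [].
have W_incr x y : good x -> good y -> D (Phi x, Phi y) != 0 /\ W y - W x =
    (y.1 - x.1) * (D (Phi x, Phi y))^-1
    + (y.2 - x.2) * - (E (Phi x, Phi y) / D (Phi x, Phi y)).
  move=> [Ux Gx] [Uy Gy]; have [lt_D _] := UDE _ _ Ux Uy.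
  have D0 : D (Phi x, Phi y) != 0 by rewrite -normr_gt0 (lt_trans m_gt0).
  split=> //; have := GE (Phi x) (Phi y); rewrite Gx Gy /= => ->.
  by field.
have W_lip x y : good x -> good y ->
    `|W y - W x| <= (`|y.1 - x.1| + `|y.2 - x.2| * M) / m.
  move=> gx gy; have [D0 ->] := W_incr x y gx gy.
  have [[Ux _] [Uy _]] := (gx, gy); have [lt_D lt_E] := UDE _ _ Ux Uy.
  have -> : (y.1 - x.1) * (D (Phi x, Phi y))^-1
      + (y.2 - x.2) * - (E (Phi x, Phi y) / D (Phi x, Phi y))
    = ((y.1 - x.1) - (y.2 - x.2) * E (Phi x, Phi y)) / D (Phi x, Phi y).
    by ring.
  rewrite normrM normfV; apply: ler_pM => //; rewrite ?invr_ge0 //.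
    rewrite (le_trans (ler_normB _ _)) // lerD2l normrM ler_wpM2l //.
    exact: ltW.
  have D_gt0 := lt_trans m_gt0 lt_D.
  by rewrite lef_pV2 ?posrE // ltW.
split=> //.
  have /nbhs_interior near_good2 := near_good.
  rewrite /holomorphic_near; apply: filterS near_good2 => x near_good_x.
  have good_x : good x := nbhs_singleton near_good_x.
  (* The Lipschitz bound makes W continuous at x, so D and E can be evaluated
     along the graph of W. *)
  have cW : W y @[y --> x] --> W x.
    apply/cvgrPdist_le => e e_gt0.
    have e1_gt0 : 0 < e * m / 2 by rewrite divr_gt0 // mulr_gt0.
    have e2_gt0 : 0 < e * m / 2 / M by exact: divr_gt0.
    have near1 : \forall y \near x, `|y.1 - x.1| <= e * m / 2.
      have c1 : y.1 @[y --> x] --> x.1 by exact: cvg_fst.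
      move/cvgrPdist_le: c1 => /(_ _ e1_gt0).
      by apply: filterS => y; rewrite distrC.
    have near2 : \forall y \near x, `|y.2 - x.2| <= e * m / 2 / M.
      have c2 : y.2 @[y --> x] --> x.2 by exact: cvg_snd.
      move/cvgrPdist_le: c2 => /(_ _ e2_gt0).
      by apply: filterS => y; rewrite distrC.
    near=> y.
    have good_y : good y by near: y.
    rewrite distrC (le_trans (W_lip _ _ good_x good_y)) // ler_pdivrMr //.
    rewrite [e * m]splitr lerD //; first by near: y.
    by rewrite -ler_pdivlMr //; near: y.
  have cPhi : Phi y @[y --> x] --> Phi x.
    by apply: (@cvg_pair _ _ _ _ (nbhs (W x)) (nbhs x.2)) => //; exact: cvg_snd.
  have cPair : {for x, continuous (fun y => (Phi x, Phi y))}.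
    by apply: (@cvg_pair _ _ _ _ (nbhs (Phi x)) (nbhs (Phi x))) => //;
      exact: cvg_cst.
  have cDx : {for x, continuous (fun y => D (Phi x, Phi y))}.
    exact: (continuous_comp cPair (cD _)).
  have cEx : {for x, continuous (fun y => E (Phi x, Phi y))}.
    exact: (continuous_comp cPair (cE _)).
  have [Dx0 _] := W_incr x x good_x good_x.
  apply: (@differentiable_increment _ _ (fun y => (D (Phi x, Phi y))^-1)
    (fun y => - (E (Phi x, Phi y) / D (Phi x, Phi y)))).
  - exact: cvgV.
  - by apply: cvgN; apply: cvgM => //; exact: cvgV.
  - by apply: filterS near_good_x => y /(W_incr x y good_x) [].
have cG : (x.1 * S x, x.2) @[x --> ((0, 0) : C * C)] --> ((0, 0) : C * C).
  apply: (@cvg_pair _ _ _ _ (nbhs 0) (nbhs 0)); last exact: cvg_snd.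
  have c1 : x.1 @[x --> ((0, 0) : C * C)] --> (0 : C) by exact: cvg_fst.
  have cM : x.1 * S x @[x --> ((0, 0) : C * C)] --> 0 * S (0, 0).
    exact: (cvgM c1 (cS (0, 0))).
  by rewrite mul0r in cM; exact: cM.
have near_U : \forall x \near ((0, 0) : C * C), U x by [].
have near_goodG : \forall x \near ((0, 0) : C * C), good (x.1 * S x, x.2).
  exact: cG near_good.
apply: filterS2 near_U near_goodG => x Ux [Uy /= Gy].
have [lt_D _] := UDE _ _ Ux Uy.
have D0 : D (x, Phi (x.1 * S x, x.2)) != 0.
  by rewrite -normr_gt0 (lt_trans m_gt0).
(* x and Phi (x.1 * S x, x.2) have the same second coordinate, and the same
   image under G. *)
have := GE x (Phi (x.1 * S x, x.2)).
rewrite /= Gy !subrr mul0r addr0 => /esym/eqP.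
by rewrite mulf_eq0 (negbTE D0) orbF subr_eq0 => /eqP.
Unshelve. all: by end_near. Qed.

End LocalInverse.

(** * Analytic isomorphisms and the normal form of two tangent branches *)

Section AnalyticIsomorphism.
Variable C : numFieldType.
Implicit Types (g h k : C * C -> C) (p q r : C * C).

Lemma holomorphic_near_continuous (V W : normedModType C) (f : V -> W) (p : V) :
  holomorphic_near f p -> f x @[x --> p] --> f p.
Proof. by move=> /nbhs_singleton; exact: differentiable_continuous. Qed.

Lemma holomorphic_near_comp (V W Z : normedModType C) (f : V -> W) (g : W -> Z)
    (p : V) :
    holomorphic_near f p -> holomorphic_near g (f p) ->
  holomorphic_near (g \o f) p.
Proof.
move=> hf hg; have /(_ _ hg) near_g := holomorphic_near_continuous hf.
rewrite /holomorphic_near; apply: filterS2 hf near_g => x df dg.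
exact: differentiable_comp.
Qed.

Lemma analytically_isomorphic_trans g p h q k r :
    analytically_isomorphic g p h q -> analytically_isomorphic h q k r ->
  analytically_isomorphic g p k r.
Proof.
move=> [phi [psi [u [[phip psiq] [hphi hpsi] [phiK psiK] [hu up] gE]]]].
move=> [phi' [psi' [u' [[phiq psir] [hphi' hpsi'] [phiK' psiK'] [hu' uq] hE]]]].
have cphi := holomorphic_near_continuous hphi; rewrite phip in cphi.
have cpsi' := holomorphic_near_continuous hpsi'; rewrite psir in cpsi'.
exists (phi' \o phi), (psi \o psi'), (fun x => u x * u' (phi x)); split.
- by rewrite /= phip psir.
- by split; apply: holomorphic_near_comp; rewrite ?phip ?psir.
- split.
    apply: filterS2 phiK (cphi _ phiK') => x psix /= psix'.
    by rewrite psix'.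
  apply: filterS2 psiK' (cpsi' _ psiK) => x psix /= psix'.
  by rewrite psix'.
- split; last by rewrite mulf_neq0 ?phip.
  have hu'phi : holomorphic_near (u' \o phi) p.
    by apply: holomorphic_near_comp; rewrite ?phip.
  rewrite /holomorphic_near; apply: filterS2 hu hu'phi => x du du'.
  exact: differentiableM.
- by apply: filterS2 gE (cphi _ hE) => x -> /= ->; rewrite mulrA.
Qed.

(** Covers all the coordinate changes below except the one whose inverse is not
    polynomial. *)
Lemma polynomial_automorphism g p h q (phi psi : C * C -> C * C) (u : C) :
    has_increments (fst \o phi) -> has_increments (snd \o phi) ->
    has_increments (fst \o psi) -> has_increments (snd \o psi) ->
    cancel phi psi -> cancel psi phi -> phi p = q -> u != 0 ->
    (forall x, g x = u * h (phi x)) ->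
  analytically_isomorphic g p h q.
Proof.
have holo (f : C * C -> C * C) (x : C * C) : has_increments (fst \o f) ->
    has_increments (snd \o f) -> holomorphic_near f x.
  move=> f1 f2; apply: (@filterE _ (nbhs x)) => y.
  have -> : f = (fun z => ((fst \o f) z, (snd \o f) z)).
    by apply: funext => z /=; case: (f z).
  by apply: differentiable_pair; exact: has_increments_differentiable.
move=> phi1 phi2 psi1 psi2 phiK psiK phip u0 gE.
exists phi, psi, (fun=> u); split=> //.
- by rewrite -phip phiK.
- by split; exact: holo.
- by split; [exact: (@filterE _ (nbhs p)) | exact: (@filterE _ (nbhs q))].
- split=> //; apply: (@filterE _ (nbhs p)) => y.
  exact: (has_increments_differentiable _ (has_increments_cst u)).
- exact: (@filterE _ (nbhs p)).
Qed.

End AnalyticIsomorphism.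

Ltac increments :=
  repeat first [ apply: has_incrementsD | apply: has_incrementsM
               | apply: has_incrementsX
               | exact: has_increments_cst | exact: has_increments_fst
               | exact: has_increments_snd ].

Section NormalForm.
Variable C : numClosedFieldType.

(** Completing the square: w (w + t) = (w + t / 2)^2 - t^2 / 4 with t = z^n, and
    - 1 / 4 is absorbed in z by a 2n-th root. *)
Lemma tangent_branches_type_A (n : nat) : (0 < n)%N ->
  analytically_isomorphic (fun x : C * C => x.1 * (x.1 + x.2 ^+ n)) (0, 0)
    (fun y => y.1 ^+ 2 + y.2 ^+ (2 * n)) (0, 0).
Proof.
move=> n_gt0; have n2_gt0 : (0 < 2 * n)%N by rewrite muln_gt0.
pose c : C := (2 * n).-root (- 4^-1).
have cX : c ^+ (2 * n) = - 4^-1 by rewrite rootCK.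
have c0 : c != 0.
  apply/eqP => c0; move/eqP: cX; rewrite c0 expr0n gtn_eqF //= eq_sym oppr_eq0.
  by rewrite invr_eq0 pnatr_eq0.
apply: (@polynomial_automorphism _ _ _ _ _
  (fun x => (x.1 + 2^-1 * x.2 ^+ n, c * x.2))
  (fun y => (y.1 + - 2^-1 * (c^-1 * y.2) ^+ n, c^-1 * y.2)) 1).
- by rewrite /comp /=; increments.
- by rewrite /comp /=; increments.
- by rewrite /comp /=; increments.
- by rewrite /comp /=; increments.
- by move=> [w z] /=; rewrite mulKf // mulNr addrK.
- by move=> [w z] /=; rewrite mulVKf // mulNr subrK.
- by rewrite /= !mulr0 expr0n gtn_eqF //= mulr0 addr0.
- exact: oner_neq0.
- move=> [w z] /=; rewrite exprMn cX mulnC exprM; set t := z ^+ n.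
  by field.
Qed.

(** With w' = w S the equation w (w S + z^n) becomes w' (w' + z^n) / S. *)
Lemma two_branches_type_A (n N : nat) (S : C * C -> C) (p : C -> {poly C}) :
    (0 < n)%N -> has_increments S -> S (0, 0) != 0 ->
    (forall x, S x = (p x.2).[x.1]) -> (forall z, size (p z) <= N)%N ->
  analytically_isomorphic (fun x => x.1 ^+ 2 * S x + x.1 * x.2 ^+ n) (0, 0)
    (fun y => y.1 ^+ 2 + y.2 ^+ (2 * n)) (0, 0).
Proof.
move=> n_gt0 SI S0 SE size_p.
apply: analytically_isomorphic_trans (tangent_branches_type_A n_gt0).
have [K [W [K_gt0 W_sol]]] := small_solution SI S0 SE size_p.
have [W0 W_holo WK] := small_solution_inverse SI S0 K_gt0 W_sol.
have dS x : differentiable S x by exact: has_increments_differentiable.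
have dsnd (x : C * C) : differentiable (@snd C C) x.
  exact: (has_increments_differentiable _ (has_increments_snd C)).
exists (fun x => (x.1 * S x, x.2)), (fun y => (W y, y.2)), (fun x => (S x)^-1).
have near_S : \forall x \near ((0, 0) : C * C), S x != 0.
  have cS : S x @[x --> ((0, 0) : C * C)] --> S (0, 0).
    exact: has_increments_continuous.
  exact: (cvgr_neq0 _ cS).
split.
- by rewrite /= mul0r W0.
- split.
    apply: (@filterE _ (nbhs ((0, 0) : C * C))) => x.
    apply: differentiable_pair => //.
    apply: has_increments_differentiable.
    by apply: has_incrementsM => //; exact: has_increments_fst.
  rewrite /holomorphic_near; apply: filterS W_holo => x dW.
  by apply: differentiable_pair.
- split.
    by apply: filterS WK => x /= ->; case: x.
  by apply: filterS W_sol => x /= [_ ->]; case: x.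
- split; last by rewrite invr_eq0.
  rewrite /holomorphic_near; apply: filterS near_S => x.
  exact: differentiableV.
- by apply: filterS near_S => x Sx0 /=; field.
Qed.

(** For n = 1 the coefficient s may vanish, so w' = s w is not available; the
    two branches are distinct lines and one takes their equations as coordinates
    instead. *)
Lemma transverse_lines_type_A (s : C) :
  analytically_isomorphic (fun x : C * C => x.1 ^+ 2 * s + x.1 * x.2) (0, 0)
    (fun y => y.1 ^+ 2 + y.2 ^+ 2) (0, 0).
Proof.
apply: analytically_isomorphic_trans (@tangent_branches_type_A 1 isT).
apply: (@polynomial_automorphism _ _ _ _ _
  (fun x => (x.1, (s - 1) * x.1 + x.2))
  (fun y => (y.1, - (s - 1) * y.1 + y.2)) 1).
- by rewrite /comp /=; increments.
- by rewrite /comp /=; increments.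
- by rewrite /comp /=; increments.
- by rewrite /comp /=; increments.
- by move=> [w z] /=; congr pair; ring.
- by move=> [w z] /=; congr pair; ring.
- by rewrite /= mulr0 addr0.
- exact: oner_neq0.
- by move=> [w z] /=; ring.
Qed.

End NormalForm.

(** * The equation at the point (- b2 : a2 : 0) *)

Lemma exprD_order2 (A : comPzRingType) (m : nat) (x t w : A) :
  (x + t * w) ^+ m.+2 = x ^+ m.+2 + m.+2%:R * (t * x ^+ m.+1 * w)
    + w ^+ 2 * \sum_(i < m.+1)
        (x ^+ (m - i) * t ^+ i.+2) *+ 'C(m.+2, i.+2) * w ^+ i.
Proof.
rewrite exprDn 2!big_ord_recl /= subn0 subn1 /= /bump /= bin0 bin1.
rewrite expr0 mulr1 expr1 mulr1n addrA; congr (_ + _ + _).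
  by rewrite mulr_natl mulrCA mulrA.
rewrite mulr_sumr; apply: eq_bigr => i _.
rewrite !add1n !subSS exprMn -[i.+2]add2n [w ^+ (2 + i)]exprD.
by rewrite !mulrnAl mulrnAr; congr (_ *+ _); ring.
Qed.

Lemma meval_normal_form (F : fieldType) (d : nat) (a1 b1 a2 b2 c2 : F)
    (v : 'I_3 -> F) :
  ('X_0 ^+ d + 'X_1 ^+ d + 'X_2 ^+ d + (a1 *: 'X_0 + b1 *: 'X_1) ^+ d
   + (a2 *: 'X_0 + b2 *: 'X_1 + c2 *: 'X_2) ^+ d).@[v]
  = v 0 ^+ d + v 1 ^+ d + v 2 ^+ d + (a1 * v 0 + b1 * v 1) ^+ d
    + (a2 * v 0 + b2 * v 1 + c2 * v 2) ^+ d.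
Proof. by rewrite !mevalD !rmorphXn /= !mevalD !mevalZ !mevalXU. Qed.

Section Computation.
Variables (C : numClosedFieldType) (m : nat) (a1 b1 a2 b2 c2 : C).
Let f : {mpoly C[3]} :=
  'X_0 ^+ m.+2 + 'X_1 ^+ m.+2 + 'X_2 ^+ m.+2 + (a1 *: 'X_0 + b1 *: 'X_1) ^+ m.+2
  + (a2 *: 'X_0 + b2 *: 'X_1 + c2 *: 'X_2) ^+ m.+2.
Hypotheses (a1_neq0 : a1 != 0) (b1_neq0 : b1 != 0) (a2_neq0 : a2 != 0)
  (b2_neq0 : b2 != 0) (c2_neq0 : c2 != 0).
Hypotheses (cond1 : b2 ^+ m.+1 + a1 * (a1 * b2 - a2 * b1) ^+ m.+1 = 0)
  (cond2 : (-1) ^+ m.+2 * b1 * b2 ^+ m.+1 + a1 * a2 ^+ m.+1 = 0)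
  (cond3 : c2 ^+ m.+2 + 1 = 0).

(* The degree is m.+2; e is the value of a1 x + b1 y at (x, y) = (1, y0). *)
Let y0 : C := - a2 / b2.
Let e : C := a1 + b1 * y0.

Lemma dehomogenize_normal_form (x : C * C) : dehomogenize f 0 x =
  1 + x.1 ^+ m.+2 + x.2 ^+ m.+2 + (a1 + b1 * x.1) ^+ m.+2
  + (a2 + b2 * x.1 + c2 * x.2) ^+ m.+2.
Proof.
have chartE (i : 'I_3) : (if unlift 0 i is Some j
    then (if j == ord0 then x.1 else x.2) else 1) = [:: 1; x.1; x.2]`_i.
  by case: unliftP => [j ->|-> //]; case: j => [[|[|//]]].
rewrite /dehomogenize (meval_eq _ chartE) /f.
by rewrite meval_normal_form /= expr1n !mulr1.
Qed.

Lemma cond1_dehomogenized : 1 + a1 * e ^+ m.+1 = 0.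
Proof.
apply: (mulfI (expf_neq0 m.+1 b2_neq0)); rewrite mulr0 -[RHS]cond1.
have -> : a1 * b2 - a2 * b1 = b2 * e by rewrite /e /y0; field.
by rewrite exprMn; ring.
Qed.

Lemma cond2_dehomogenized : y0 ^+ m.+1 + b1 * e ^+ m.+1 = 0.
Proof.
have a1e : a1 * e ^+ m.+1 = -1.
  by apply/eqP; rewrite -addr_eq0 addrC cond1_dehomogenized.
apply: (mulfI a1_neq0); rewrite mulr0 mulrDr mulrCA a1e.
apply: (mulfI (expf_neq0 m.+1 b2_neq0)); rewrite mulr0.
have y0E : b2 ^+ m.+1 * y0 ^+ m.+1 = (- 1) ^+ m.+1 * a2 ^+ m.+1.
  by rewrite -!exprMn /y0; congr (_ ^+ _); field.
rewrite mulrDr mulrCA y0E.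
have -> : a1 * ((-1) ^+ m.+1 * a2 ^+ m.+1) = (-1) ^+ m.+1 * (a1 * a2 ^+ m.+1).
  by ring.
have -> : a1 * a2 ^+ m.+1 = - ((-1) ^+ m.+2 * b1 * b2 ^+ m.+1).
  by apply/eqP; rewrite -addr_eq0 addrC cond2.
rewrite [(-1) ^+ m.+2]exprS.
have -> : (-1) ^+ m.+1 * - (-1 * (-1) ^+ m.+1 * b1 * b2 ^+ m.+1)
    = ((-1) ^+ m.+1 * (-1) ^+ m.+1) * (b1 * b2 ^+ m.+1) :> C by ring.
by rewrite -exprMn mulrNN mulr1 expr1n; ring.
Qed.

(** Euler's relation for the binary form x^d + y^d + (a1 x + b1 y)^d: the first
    two conditions annihilate its partial derivatives at (1, y0), so its value
    there is zero as well. *)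
Lemma value_at_y0 : 1 + y0 ^+ m.+2 + e ^+ m.+2 = 0.
Proof.
have one : 1 = - (a1 * e ^+ m.+1).
  by apply/eqP; rewrite -addr_eq0 cond1_dehomogenized.
have y0E : y0 ^+ m.+1 = - (b1 * e ^+ m.+1).
  by apply/eqP; rewrite -addr_eq0 cond2_dehomogenized.
rewrite {1}one ![_ ^+ m.+2]exprS y0E.
have -> : - (a1 * e ^+ m.+1) + y0 * - (b1 * e ^+ m.+1) + e * e ^+ m.+1
    = e ^+ m.+1 * (e - (a1 + b1 * y0)) by ring.
by rewrite subrr mulr0.
Qed.

(** By [cond2_dehomogenized], y0 times the left-hand side is - a1 b1 e^m, and e
    is nonzero because of [cond1_dehomogenized]. *)
Lemma second_derivative_neq0 : y0 ^+ m + b1 ^+ 2 * e ^+ m != 0.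
Proof.
have e0 : e != 0.
  apply/eqP => e0; move: cond1_dehomogenized.
  by rewrite e0 expr0n /= mulr0 addr0 => /eqP; rewrite oner_eq0.
have y0E : y0 ^+ m.+1 = - (b1 * e ^+ m.+1).
  by apply/eqP; rewrite -addr_eq0 cond2_dehomogenized.
have : y0 * (y0 ^+ m + b1 ^+ 2 * e ^+ m) = - (a1 * b1 * e ^+ m).
  by rewrite mulrDr -exprS y0E exprS /e; ring.
apply: contra_eq_neq => ->; rewrite mulr0 eq_sym oppr_eq0.
by rewrite !mulf_neq0 ?expf_neq0.
Qed.

(* The coefficient of w z^(d-1) in (b2 w + c2 z)^d. *)
Let beta : C := m.+2%:R * b2 * c2 ^+ m.+1.

(* beta * S collects the terms of order at least 2 in w of the binomial
   expansions of y^d, (a1 + b1 y)^d and (b2 w + c2 z)^d, divided by w^2. *)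
Let coef (z : C) (i : nat) : C :=
  beta^-1 * ((y0 ^+ (m - i) + e ^+ (m - i) * b1 ^+ i.+2
              + (c2 * z) ^+ (m - i) * b2 ^+ i.+2) *+ 'C(m.+2, i.+2)).

Let S (x : C * C) : C := \sum_(i < m.+1) coef x.2 i * x.1 ^+ i.

Lemma beta_neq0 : beta != 0.
Proof. by rewrite !mulf_neq0 ?expf_neq0 ?pnatr_eq0. Qed.

(** The constant terms cancel by [value_at_y0], the pure powers of z by
    c2^d = - 1, and of the terms linear in w only the one from
    (b2 w + c2 z)^d survives, by [cond2_dehomogenized]. *)
Lemma translated_equation (x : C * C) :
  dehomogenize f 0 (y0 + x.1, x.2)
    = beta * (x.1 ^+ 2 * S x + x.1 * x.2 ^+ m.+1).
Proof.
rewrite dehomogenize_normal_form /=; case: x => w z /=.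
have -> : a1 + b1 * (y0 + w) = e + b1 * w by rewrite /e; ring.
have -> : a2 + b2 * (y0 + w) + c2 * z = c2 * z + b2 * w by rewrite /y0; field.
rewrite -{1}[w]mul1r (exprD_order2 m y0) (exprD_order2 m e).
rewrite (exprD_order2 m (c2 * z)).
have -> : \sum_(i < m.+1) (y0 ^+ (m - i) * 1 ^+ i.+2) *+ 'C(m.+2, i.+2) * w ^+ i
  = \sum_(i < m.+1) y0 ^+ (m - i) *+ 'C(m.+2, i.+2) * w ^+ i.
  by apply: eq_bigr => i _; rewrite expr1n mulr1.
have SE : beta * S (w, z)
  = \sum_(i < m.+1) y0 ^+ (m - i) *+ 'C(m.+2, i.+2) * w ^+ i
  + \sum_(i < m.+1) (e ^+ (m - i) * b1 ^+ i.+2) *+ 'C(m.+2, i.+2) * w ^+ i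
  + \sum_(i < m.+1)
      ((c2 * z) ^+ (m - i) * b2 ^+ i.+2) *+ 'C(m.+2, i.+2) * w ^+ i.
  rewrite -!big_split mulr_sumr; apply: eq_bigr => i _ /=.
  by rewrite /coef mulrA mulVKf ?beta_neq0 // !mulrnDl !mulrDl.
have constE : 1 + y0 ^+ m.+2 + e ^+ m.+2 = 0 := value_at_y0.
have linE := cond2_dehomogenized.
have c2X : (c2 * z) ^+ m.+2 = - z ^+ m.+2.
  rewrite exprMn (_ : c2 ^+ m.+2 = - 1) ?mulN1r //.
  by apply/eqP; rewrite -addr_eq0 cond3.
have betaE : beta * z ^+ m.+1 = m.+2%:R * (b2 * (c2 * z) ^+ m.+1).
  by rewrite exprMn /beta; ring.
rewrite [RHS]mulrDr [in X in _ = X + _]mulrCA SE.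
have -> : beta * (w * z ^+ m.+1) = m.+2%:R * (w * (b2 * (c2 * z) ^+ m.+1)).
  by rewrite mulrCA betaE mulrCA.
rewrite c2X.
set s1 := \sum_(i < m.+1) y0 ^+ _ *+ _ * _.
set s2 := \sum_(i < m.+1) (e ^+ _ * _) *+ _ * _.
set s3 := \sum_(i < m.+1) ((c2 * z) ^+ _ * _) *+ _ * _.
transitivity ((1 + y0 ^+ m.+2 + e ^+ m.+2)
  + m.+2%:R * (w * (y0 ^+ m.+1 + b1 * e ^+ m.+1))
  + (w ^+ 2 * (s1 + s2 + s3) + m.+2%:R * (w * (b2 * (c2 * z) ^+ m.+1)))).
  rewrite mul1r.
  move: (y0 ^+ m.+2) (y0 ^+ m.+1) (e ^+ m.+2) (e ^+ m.+1) (z ^+ m.+2).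
  move: ((c2 * z) ^+ m.+1) (m.+2%:R) s1 s2 s3 => *; ring.
by rewrite constE linE !mulr0 !add0r.
Qed.

Lemma S_has_increments : has_increments S.
Proof.
apply: has_increments_sum => i; apply: has_incrementsM; last first.
  exact: has_incrementsX (has_increments_fst C).
under eq_fun do rewrite /coef -[_ *+ 'C(_, _)]mulr_natr.
by increments.
Qed.

Lemma normal_form_type_A :
  singularity_of_type_A (2 * m.+2 - 3) f (\row_(i < 3) [:: - b2; a2; 0]`_i).
Proof.
rewrite (_ : (2 * m.+2 - 3 = (2 * m.+1).-1)%N); last by lia.
split; first by lia.
exists 0; first by rewrite mxE /= oppr_eq0.
have -> : affine_point (\row_(i < 3) [:: - b2; a2; 0]`_i) 0 = (y0, 0).
  by rewrite /affine_point !mxE /= mul0r /y0 invrN mulrN mulNr.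
have -> : ((2 * m.+1).-1.+1 = 2 * m.+1)%N by lia.
have shift_iso (g : C * C -> C) :
    (forall x, dehomogenize f 0 (y0 + x.1, x.2) = beta * g x) ->
  analytically_isomorphic (dehomogenize f 0) (y0, 0) g (0, 0).
  move=> gE; apply: (@polynomial_automorphism _ _ _ _ _
    (fun x => (- y0 + x.1, x.2)) (fun x => (y0 + x.1, x.2)) beta).
  - by rewrite /comp /=; increments.
  - by rewrite /comp /=; increments.
  - by rewrite /comp /=; increments.
  - by rewrite /comp /=; increments.
  - by move=> [w z] /=; rewrite addNKr.
  - by move=> [w z] /=; rewrite addKr.
  - by rewrite /= addNr.
  - exact: beta_neq0.
  - by move=> [w z]; rewrite -gE /= addNKr.
have translated := shift_iso _ translated_equation.
apply: analytically_isomorphic_trans translated _.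
have [m0|m_gt0] := posnP m.
  have SE x : S x = S (0, 0).
    by rewrite /S m0 !big_ord1 /coef m0 !subn0 !expr0.
  have -> : (fun x : C * C => x.1 ^+ 2 * S x + x.1 * x.2 ^+ m.+1)
      = (fun x => x.1 ^+ 2 * S (0, 0) + x.1 * x.2).
    by apply: funext => x; rewrite SE m0 expr1.
  rewrite (_ : (2 * m.+1 = 2)%N); last by rewrite m0.
  exact: transverse_lines_type_A.
apply: (@two_branches_type_A _ _ m.+1 _
  (fun z => \poly_(i < m.+1) coef z i)) => //.
- exact: S_has_increments.
- rewrite /S big_ord_recl /= expr0 mulr1 big1 => [|i _].
    rewrite addr0 /coef /= mulr0 subn0 [0 ^+ m]expr0n gtn_eqF // mul0r addr0.
    rewrite mulf_neq0 ?invr_eq0 ?beta_neq0 //.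
    rewrite -[_ *+ 'C(_, _)]mulr_natr mulf_neq0 ?pnatr_eq0 -?lt0n ?bin_gt0 //.
    by rewrite [e ^+ _ * _]mulrC second_derivative_neq0.
  by rewrite /= expr0n /= mulr0.
- by move=> x; rewrite horner_poly.
Qed.

End Computation.

(** * Linear forms and line arrangements *)

Section LinearForms.
Variable C : fieldType.
Implicit Types (u v w : 'rV[C]_3) (A : 'M[C]_3).

Definition linear_form w : {mpoly C[3]} := \sum_(j < 3) w 0 j *: 'X_j.

Definition dot w v : C := (w *m v^T) 0 0.

Lemma linear_form_homog w : linear_form w \is 1.-homog.
Proof.
by rewrite rpred_sum // => j _; rewrite dhomogZ // dhomogX /= mdeg1.
Qed.

Lemma homog1_linear_form (p : {mpoly C[3]}) :
  p \is 1.-homog -> exists w, p = linear_form w.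
Proof.
move=> p_homog; exists (\row_j p@_(U_(j))%MM); apply/mpolyP => n.
rewrite /linear_form raddf_sum /=.
have [/eqP|/= n_neq1] := eqVneq (mdeg n) 1%N.
  rewrite mdeg_eq1 => /existsP[i /eqP ->].
  rewrite (bigD1 i) //= mcoeffZ mxE mcoeffXU eqxx mulr1 big1 ?addr0 // => j ji.
  by rewrite mcoeffZ mcoeffXU (negPf ji) mulr0.
rewrite (dhomog_nemf_coeff p_homog) // big1 // => j _.
rewrite mcoeffZ mcoeffX [(_ == n)]negbTE ?mulr0 //.
by apply: contraNneq n_neq1 => <-; rewrite mdeg1.
Qed.

Lemma linear_formZ (c : C) w : linear_form (c *: w) = c *: linear_form w.
Proof.
by rewrite scaler_sumr; apply: eq_bigr => j _; rewrite mxE scalerA.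
Qed.

Lemma linear_formD v w : linear_form (v + w) = linear_form v + linear_form w.
Proof.
by rewrite -big_split; apply: eq_bigr => j _; rewrite mxE scalerDl.
Qed.

Lemma linear_form_delta (j : 'I_3) : linear_form (delta_mx 0 j) = 'X_j.
Proof.
rewrite /linear_form (bigD1 j) //= mxE !eqxx scale1r big1 ?addr0 // => i ij.
by rewrite mxE eqxx (negPf ij) scale0r.
Qed.

Lemma meval_linear_form w v : (linear_form w).@[v 0] = dot w v.
Proof.
rewrite /linear_form raddf_sum /dot mxE; apply: eq_bigr => j _ /=.
by rewrite mevalZ mevalXU mxE.
Qed.

Lemma dotDl u w v : dot (u + w) v = dot u v + dot w v.
Proof. by rewrite /dot mulmxDl mxE. Qed.

Lemma dotZl (c : C) w v : dot (c *: w) v = c * dot w v.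
Proof. by rewrite /dot -scalemxAl mxE. Qed.

Lemma dotZr (c : C) w v : dot w (c *: v) = c * dot w v.
Proof. by rewrite /dot linearZ -scalemxAr mxE. Qed.

Lemma lin_subst_linear_form A w :
  lin_subst A (linear_form w) = linear_form (w *m A).
Proof.
rewrite /lin_subst /linear_form raddf_sum /=.
under eq_bigr do
  rewrite comp_mpolyZ comp_mpolyXU -tnth_nth tnth_mktuple scaler_sumr.
rewrite exchange_big; apply: eq_bigr => j _ /=.
by rewrite mxE scaler_suml; apply: eq_bigr => i _; rewrite scalerA.
Qed.

Lemma lin_subst_sum_powers A (I : finType) (w : I -> 'rV[C]_3) (d : nat) :
  lin_subst A (\sum_i linear_form (w i) ^+ d)
    = \sum_i linear_form (w i *m A) ^+ d.
Proof.
rewrite [LHS]/lin_subst raddf_sum; apply: eq_bigr => i _.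
by rewrite -lin_subst_linear_form -rmorphXn.
Qed.

Lemma sum_powers_normal_form (d : nat) (a1 b1 a2 b2 c2 : C) :
  \sum_(w <- [:: delta_mx 0 0; delta_mx 0 1; delta_mx 0 2;
                 a1 *: delta_mx 0 0 + b1 *: delta_mx 0 1;
                 a2 *: delta_mx 0 0 + b2 *: delta_mx 0 1 + c2 *: delta_mx 0 2])
     linear_form w ^+ d
  = 'X_0 ^+ d + 'X_1 ^+ d + 'X_2 ^+ d + (a1 *: 'X_0 + b1 *: 'X_1) ^+ d
    + (a2 *: 'X_0 + b2 *: 'X_1 + c2 *: 'X_2) ^+ d.
Proof.
rewrite !big_cons big_nil addr0 !linear_formD !linear_formZ !linear_form_delta.
by rewrite !addrA.
Qed.

Definition point_of v (v0 : v != 0) : proj_plane C :=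
  exist _ <[v]>%VS (introT eqP (etrans (dim_vline v) (congr1 nat_of_bool v0))).

Lemma proj_planeP (P : proj_plane C) : exists v (v0 : v != 0), P = point_of v0.
Proof.
case: P => U dimU; have U0 : U != 0%VS by rewrite -dimv_eq0 (eqP dimU).
have v0 : vpick U != 0 by rewrite vpick0.
exists (vpick U), v0; apply: eq_exist; apply/eqP => /=.
by rewrite eq_sym eqEdim dim_vline v0 (eqP dimU) andbT -memvE memv_pick.
Qed.

Lemma incidence w v (v0 : v != 0) :
  proj_zeros (linear_form w) (point_of v0) <-> dot w v = 0.
Proof.
split=> [wv|wv u /vlineP[k ->]]; last first.
  by rewrite meval_linear_form dotZr wv mulr0.
by rewrite -meval_linear_form; apply: wv; exact: memv_line.
Qed.

(** A form that vanishes on the kernel of w is a multiple of w; the columns of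
    the cokernel matrix of w span that kernel. *)
Lemma proj_zeros_sub w w' :
  (proj_zeros (linear_form w) `<=` proj_zeros (linear_form w'))%classic ->
  (w' <= w)%MS.
Proof.
move=> sub; rewrite submxE; apply/eqP/matrixP => r k; rewrite ord1 [RHS]mxE.
pose v := (col k (cokermx w))^T.
have dotv u : dot u v = (u *m cokermx w) 0 k.
  by rewrite /dot /v trmxK !mxE; apply: eq_bigr => j _; rewrite mxE.
have [v0|v0] := eqVneq v 0; first by rewrite -dotv v0 /dot trmx0 mulmx0 mxE.
have /incidence wv : dot w v = 0 by rewrite dotv mulmx_coker mxE.
by rewrite -dotv; apply/(incidence _ v0)/sub.
Qed.

End LinearForms.

Section Arrangement.
Variable C : fieldType.

Lemma card_eq_finset (T : finType) (B : {set T}) (n : nat) :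
  ([set` B] #= `I_n)%card = (#|B| == n).
Proof.
have B_card : ([set` B] #= `I_#|B|)%card.
  have -> : [set` B] = [set enum_val i | i in [set: 'I_#|B|]]%classic.
    apply/seteqP; split=> [x xB|_ [i _ <-]]; last exact: enum_valP.
    by exists (enum_rank_in xB x) => //; rewrite enum_rankK_in.
  rewrite (card_eql (inj_card_eq _)); first by rewrite card_eq_sym card_II.
  by move=> i j _ _; exact: enum_val_inj.
rewrite (card_eql B_card).
by apply/card_eq_II/eqP.
Qed.

Lemma card_eq1_unique (T : Type) (A : set T) : (A #= `I_1)%card ->
  exists2 x, A x & forall y, A y -> y = x.
Proof.
move=> /pcard_eqP[g].
have [x Ax _] : (g @` A)%classic 0%N by apply: surj.
exists x => // y Ay; apply: (@inj _ _ _ g); rewrite ?inE //.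
have : (g x < 1)%N by exact: (@funS _ _ _ _ g).
have : (g y < 1)%N by exact: (@funS _ _ _ _ g).
by rewrite !ltnS !leqn0 => /eqP gy /eqP gx; transitivity 0%N.
Qed.

Definition vanishing (r : nat) (w : 'I_r -> 'rV[C]_3) (v : 'rV[C]_3) :
    {set 'I_r} :=
  [set i | dot (w i) v == 0]%SET.

Variables (r : nat) (w : 'I_r -> 'rV[C]_3).
Hypothesis w_distinct : forall i j, i != j -> ~~ (w i <= w j)%MS.
Let lines := line_arrangement (fun i => linear_form (w i)).

Lemma multiplicityP (k : nat) (v : 'rV[C]_3) (v0 : v != 0) :
  points_of_multiplicity lines k (point_of v0)
    <-> #|vanishing w v| = k.
Proof.
rewrite /points_of_multiplicity /=.
have -> : ([set L | lines L /\ L (point_of v0)]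
    = (fun i => proj_zeros (linear_form (w i))) @`
      [set` vanishing w v])%classic.
  apply/seteqP; split=> [L [[i _ <-] Lv]|_ [i /= iv <-]].
    by exists i => //=; rewrite inE; apply/eqP/incidence.
  by split; [exists i | apply/incidence; move: iv; rewrite inE => /eqP].
rewrite (card_eql (inj_card_eq _)); last first.
  move=> i j _ _ Zij; apply/eqP; apply: contraT => /w_distinct/negP[].
  by apply: proj_zeros_sub; rewrite Zij.
by rewrite card_eq_finset; split=> /eqP.
Qed.

(** For k = 3: a point on exactly three lines is the given triple point, so it
    lies on the same lines. *)
Lemma unique_multiple_point (k : nat) : number_of_points lines k 1 ->
  exists v : 'rV[C]_3, #|vanishing w v| = k /\
    forall u : 'rV[C]_3, u != 0 -> #|vanishing w u| = k ->
    forall i, dot (w i) v = 0 -> dot (w i) u = 0.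
Proof.
move=> /card_eq1_unique[P]; have [v [v0 ->]] := proj_planeP P.
move=> /multiplicityP v_mult P_unique; exists v; split=> // u u0 u_mult i iv.
have /(congr1 sval) /= uv :=
  P_unique (point_of u0) (proj2 (multiplicityP k u0) u_mult).
have /vlineP[c ->] : u \in <[v]>%VS by rewrite -uv memv_line.
by rewrite dotZr iv mulr0.
Qed.

End Arrangement.

(** * Coordinates adapted to the triple point *)

(** If l_i = c l_j then l_i^d + l_j^d = (1 + c^d) l_j^d is again a d-th power
    of a linear form, which shortens the decomposition. *)
Lemma waring_forms_distinct (C : numClosedFieldType) (d r : nat)
    (f : {mpoly C[3]}) (w : 'I_r -> 'rV[C]_3) :
    (0 < d)%N -> waring_rank d r f -> f = \sum_i linear_form (w i) ^+ d ->
  forall i j, i != j -> ~~ (w i <= w j)%MS.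
Proof.
case: r w => [|r] w d_gt0 [_ rank_min] fE i j ij; first by case: i ij.
apply/negP => /sub_rVP[c wi].
pose e := d.-root (1 + c ^+ d).
pose l (k : 'I_r) :=
  linear_form ((if lift i k == j then e else 1) *: w (lift i k)).
suff : (r.+1 <= r)%N by rewrite ltnn.
apply: (rank_min _ l); split=> [k|]; first exact: linear_form_homog.
have [j' jE|] := unliftP i j; last by move/eqP; rewrite eq_sym (negPf ij).
rewrite fE (bigD1_ord i) //= (bigD1 j') //= [RHS](bigD1 j') //= addrA.
congr (_ + _).
  rewrite /l -jE eqxx wi !linear_formZ !exprZn /e rootCK //.
  by rewrite scalerDl scale1r addrC.
apply: eq_bigr => k kj'; rewrite /l jE (inj_eq lift_inj) (negPf kj').
by rewrite scale1r.
Qed.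

Lemma split_three_two (B : {set 'I_5}) : #|B| = 3 ->
  exists i j k p q : 'I_5,
    [/\ uniq [:: i; j; k; p; q], perm_eq [:: i; j; k; p; q] (enum 'I_5),
        [&& i \in B, j \in B & k \in B] & (p \notin B) && (q \notin B)].
Proof.
move=> cardB; have cardC : #|~: B| = 2.
  by apply/eqP; rewrite -(eqn_add2l #|B|) cardsC cardB card_ord.
have : size (enum B) = 3 by rewrite -cardE.
have : size (enum (~: B)%SET) = 2 by rewrite -cardE.
case EC: (enum (~: B)%SET) => [|p [|q []]] //= _.
case EB: (enum B) => [|i [|j [|k []]]] //= _.
have inB x : (x \in B) = (x \in [:: i; j; k]) by rewrite -EB mem_enum.
have inC x : (x \notin B) = (x \in [:: p; q]).
  by rewrite -EC mem_enum !inE.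
have ijkpq : [:: i; j; k; p; q] = enum B ++ enum (~: B)%SET by rewrite EB EC.
have u : uniq [:: i; j; k; p; q].
  rewrite ijkpq cat_uniq !enum_uniq /= andbT.
  by apply/hasPn => x; rewrite !mem_enum inE.
exists i, j, k, p, q; split=> //.
- apply: uniq_perm => //; first exact: enum_uniq.
  by move=> x; rewrite mem_enum ijkpq mem_cat !mem_enum !inE orbN.
- by rewrite !inB !inE !eqxx !orbT.
- by rewrite !inC !inE !eqxx !orbT.
Qed.

Section NormalCoordinates.
Variables (C : fieldType) (w : 'I_5 -> 'rV[C]_3).
Hypothesis w_distinct : forall i j, i != j -> ~~ (w i <= w j)%MS.

(** The rows of [invmx A] are the forms of two lines i, j through the triple
    point v and of one line p that avoids it; k is the third line through v,
    and q the other line that avoids it.  A point (x : y : 0) always lies on p,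
    so it is a triple point as soon as it lies on exactly two of i, j, k, q; but
    the only triple point is v, which is on both i and j while (x : y : 0) is
    not. *)
Lemma normal_coordinates (v : 'rV[C]_3) : #|vanishing w v| = 3 ->
    (forall u : 'rV[C]_3, u != 0 -> #|vanishing w u| = 3 ->
      forall i, dot (w i) v = 0 -> dot (w i) u = 0) ->
  exists (A : 'M[C]_3) (s : seq 'I_5) (a1 b1 a2 b2 c2 : C),
    [/\ A \in unitmx, perm_eq s (enum 'I_5),
        [/\ a1 != 0, b1 != 0, a2 != 0, b2 != 0 & c2 != 0],
        a2 * b1 != a1 * b2
      & [seq w i *m A | i <- s] =
          [:: delta_mx 0 0; delta_mx 0 1; delta_mx 0 2;
              a1 *: delta_mx 0 0 + b1 *: delta_mx 0 1;
              a2 *: delta_mx 0 0 + b2 *: delta_mx 0 1 + c2 *: delta_mx 0 2]].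
Proof.
move=> v_triple v_unique.
have [i [j [k [p [q [s_uniq s_perm inB outB]]]]]] := split_three_two v_triple.
move: inB outB; rewrite !inE => /and3P[/eqP iv /eqP jv /eqP kv] /andP[pv qv].
have not_sub a b : a != b -> (w a <= w b)%MS -> False.
  by move=> /w_distinct/negP.
pose M : 'M[C]_3 := \matrix_(t < 3) [:: w i; w j; w p]`_t.
have combE (y : 'rV[C]_3) : y *m M = y 0 0 *: w i + y 0 1 *: w j + y 0 2 *: w p.
  rewrite mulmx_sum_row !big_ord_recl big_ord0 addr0 !rowK /= addrA.
  by congr (_ *: _ + _ *: _ + _ *: _); congr (y 0 _); exact/val_inj.
move: (s_uniq) => /= /and5P[]; rewrite !inE !negb_or.
move=> /and4P[ij ik ip iq] /and3P[jk jp jq] /andP[kp kq] pq _.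
have M_unit : M \in unitmx.
  rewrite -row_free_unit; apply: inj_row_free => y yM.
  have y2 : y 0 2 = 0.
    have := congr1 (fun u => dot u v) yM.
    rewrite combE !dotDl !dotZl iv jv !mulr0 !add0r [RHS]/dot mul0mx mxE.
    move=> /eqP; rewrite mulf_eq0 (negPf pv) orbF.
    by move/eqP.
  move: yM; rewrite combE y2 scale0r addr0 => yM.
  have y0 : y 0 0 = 0.
    apply/eqP; apply: contraT => y00.
    case: (not_sub i j ij); apply/sub_rVP; exists (- (y 0 0)^-1 * y 0 1).
    apply: (scalerI y00); rewrite scalerA mulrA mulrN mulfV // mulN1r scaleNr.
    by apply/eqP; rewrite -addr_eq0 yM.
  have y1 : y 0 1 = 0.
    apply/eqP; apply: contraT => y10; move: yM; rewrite y0 scale0r add0r.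
    move/eqP; rewrite scaler_eq0 (negPf y10) /= => /eqP wj0.
    by case: (not_sub j i); rewrite 1?eq_sym // wj0 sub0mx.
  apply/rowP => t; rewrite mxE; case: t => [[|[|[|//]]] t_lt].
  - by rewrite -[RHS]y0; congr (y 0 _); exact/val_inj.
  - by rewrite -[RHS]y1; congr (y 0 _); exact/val_inj.
  - by rewrite -[RHS]y2; congr (y 0 _); exact/val_inj.
pose A := invmx M.
have rowA (t : 'I_3) : [:: w i; w j; w p]`_t *m A = delta_mx 0 t.
  by rewrite -[RHS](mulmxK M_unit) -rowE rowK.
have coordE u :
    u = (u *m A) 0 0 *: w i + (u *m A) 0 1 *: w j + (u *m A) 0 2 *: w p.
  by rewrite -combE /A mulmxKV.
have dotE u x : dot u x
    = (u *m A) 0 0 * dot (w i) x + (u *m A) 0 1 * dot (w j) x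
    + (u *m A) 0 2 * dot (w p) x.
  by rewrite {1}(coordE u) !dotDl !dotZl.
pose a1 := (w k *m A) 0 0; pose b1 := (w k *m A) 0 1.
pose a2 := (w q *m A) 0 0; pose b2 := (w q *m A) 0 1; pose c2 := (w q *m A) 0 2.
have k2 : (w k *m A) 0 2 = 0.
  have := dotE (w k) v; rewrite kv iv jv !mulr0 !add0r => /esym/eqP.
  by rewrite mulf_eq0 (negPf pv) orbF => /eqP.
have c2_neq0 : c2 != 0.
  apply: contraNneq qv => c20.
  by rewrite dotE iv jv !mulr0 !add0r -/c2 c20 mul0r.
have kE : w k = a1 *: w i + b1 *: w j.
  by rewrite {1}(coordE (w k)) k2 scale0r addr0.
have a1_neq0 : a1 != 0.
  apply/eqP => a10; apply: (not_sub k j); first by rewrite eq_sym.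
  by rewrite kE a10 scale0r add0r scalemx_sub.
have b1_neq0 : b1 != 0.
  apply/eqP => b10; apply: (not_sub k i); first by rewrite eq_sym.
  by rewrite kE b10 scale0r addr0 scalemx_sub.
have count_vanishing u : #|vanishing w u|
    = count (fun t => dot (w t) u == 0) [:: i; j; k; p; q].
  rewrite (permP s_perm) enumT -sum1_count -sum1_card.
  by apply: eq_bigl => t; rewrite inE.
have yi : w i *m A = delta_mx 0 0 by exact: rowA 0.
have yj : w j *m A = delta_mx 0 1 by exact: rowA 1.
have yp : w p *m A = delta_mx 0 2 by exact: rowA 2.
have no_triple (x y : C) : (x != 0) || (y != 0) ->
    count (pred1 0) [:: x; y; a1 * x + b1 * y; a2 * x + b2 * y] != 2.
  move=> xy0; apply/eqP => count2.
  pose u : 'rV[C]_3 := (A *m (\col_(t < 3) [:: x; y; 0]`_t))^T.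
  have dotu t : dot (w t) u = (w t *m A) 0 0 * x + (w t *m A) 0 1 * y.
    rewrite /dot /u trmxK mulmxA; move: (w t *m A) => y'.
    rewrite mxE !big_ord_recl big_ord0 !mxE /= mulr0 !addr0.
    by congr (_ * _ + _ * _); congr (y' 0 _); exact/val_inj.
  have ui : dot (w i) u = x by rewrite dotu yi !mxE /= mul1r mul0r addr0.
  have uj : dot (w j) u = y by rewrite dotu yj !mxE /= mul1r mul0r add0r.
  have up : dot (w p) u = 0 by rewrite dotu yp !mxE /= !mul0r addr0.
  have u_neq0 : u != 0.
    apply: contraTneq xy0 => u0; rewrite -ui -uj u0 /dot trmx0 !mulmx0 mxE.
    by rewrite eqxx.
  have u_triple : #|vanishing w u| = 3.
    rewrite count_vanishing /= ui uj up eqxx !dotu.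
    by rewrite add1n !addnS; congr _.+1.
  have := v_unique u u_neq0 u_triple.
  move=> u_van; move: xy0.
  by rewrite -ui -uj (u_van i iv) (u_van j jv) eqxx.
(* a2 = 0 would make (1 : 0 : 0) a common point of j, p, q. *)
have a2_neq0 : a2 != 0.
  apply/eqP => a20; move: (no_triple 1 0); rewrite oner_neq0 /= a20 => /(_ isT).
  by rewrite !mulr0 mulr1 mul0r !addr0 eqxx oner_eq0 (negPf a1_neq0).
(* b2 = 0 would make (0 : 1 : 0) a common point of i, p, q. *)
have b2_neq0 : b2 != 0.
  apply/eqP => b20; move: (no_triple 0 1).
  rewrite oner_neq0 orbT /= b20 => /(_ isT).
  by rewrite !mulr0 mulr1 mul0r !addr0 add0r eqxx oner_eq0 (negPf b1_neq0).
(* A zero determinant would put k, p, q through (b1 : - a1 : 0). *)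
have det_neq0 : a2 * b1 != a1 * b2.
  apply/eqP => det0; move: (no_triple b1 (- a1)).
  rewrite b1_neq0 /= => /(_ isT).
  rewrite oppr_eq0 (negPf a1_neq0) (negPf b1_neq0) mulrN mulrC subrr eqxx.
  by rewrite det0 mulrN [b2 * a1]mulrC subrr eqxx.
exists A, [:: i; j; p; k; q], a1, b1, a2, b2, c2; split=> //.
- by rewrite unitmx_inv.
- by apply: perm_trans s_perm; apply/permP => P /=; rewrite [(P p + _)%N]addnCA.
- rewrite /= yi yj yp kE {1}(coordE (w q)) !mulmxDl -!scalemxAl yi yj yp.
  by [].
Qed.
End NormalCoordinates.

(** * The theorem *)

Theorem proposition5p2 (R : realType) (d : nat) (f : {mpoly R[i][3]})
    (l : 'I_5 -> {mpoly R[i][3]})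
    (f_homog : f \is d.-homog)
    (f_reduced : reduced f)
    (f_essential : essentially_three_variables f)
    (f_rank : waring_rank d 5 f)
    (f_decomposition : waring_decomposition d l f)
    (n3 : number_of_points (line_arrangement l) 3 1)
    (n2 : number_of_points (line_arrangement l) 2 7) :
  let normal_form (a1 b1 a2 b2 c2 : R[i]) : {mpoly R[i][3]} :=
    'X_0 ^+ d + 'X_1 ^+ d + 'X_2 ^+ d + (a1 *: 'X_0 + b1 *: 'X_1) ^+ d
    + (a2 *: 'X_0 + b2 *: 'X_1 + c2 *: 'X_2) ^+ d in
  let admissible (A : 'M[R[i]]_3) (a1 b1 a2 b2 c2 : R[i]) : Prop :=
    [/\ A \in unitmx,
        [/\ a1 != 0, b1 != 0, a2 != 0, b2 != 0 & c2 != 0],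
        a2 * b1 != a1 * b2
      & lin_subst A f = normal_form a1 b1 a2 b2 c2] in
  (exists (A : 'M[R[i]]_3) (a1 b1 a2 b2 c2 : R[i]),
     admissible A a1 b1 a2 b2 c2) /\
  (forall (A : 'M[R[i]]_3) (a1 b1 a2 b2 c2 : R[i]),
     admissible A a1 b1 a2 b2 c2 ->
     b2 ^+ d.-1 + a1 * (a1 * b2 - a2 * b1) ^+ d.-1 = 0 ->
     (-1) ^+ d * b1 * b2 ^+ d.-1 + a1 * a2 ^+ d.-1 = 0 ->
     c2 ^+ d + 1 = 0 ->
     singularity_of_type_A (2 * d - 3) (lin_subst A f)
       (\row_(i < 3) [:: - b2; a2; 0]`_i)).
Proof.
move=> normal_form admissible.
have [[l_homog fE] _] := f_decomposition.
have d_gt1 : (1 < d)%N.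
  (* A constant does not involve three variables; a linear form has rank at
     most 1. *)
  case: d f_homog f_rank {fE f_decomposition normal_form admissible}
      => [|[|//]] f_homog f_rank.
    case: f_essential; exists 1%:M; first exact: unitmx1.
    exists (f@_0)%:MP; rewrite mwidenC.
    have -> : f = (f@_0)%:MP.
      apply/mpolyP => n; rewrite mcoeffC.
      have [->|n0] := eqVneq 0%MM n; first by rewrite mulr1.
      rewrite mulr0 (dhomog_nemf_coeff f_homog) //=.
      by rewrite mdeg_eq0 eq_sym.
    by rewrite /lin_subst comp_mpolyC mcoeffC eqxx mulr1.
  have /(_ 1%N (fun=> f)) := f_rank.2.
  suff sum1 : sum_of_powers 1 (fun _ : 'I_1 => f) f by move/(_ sum1).
  by split=> //; rewrite big_ord1 expr1.
split; last first.
  move=> A a1 b1 a2 b2 c2 [_ [a10 b10 a20 b20 c20] _ ->].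
  rewrite /normal_form.
  case: d d_gt1 {f_homog f_rank f_decomposition fE normal_form admissible}
    => [|[|m]] //= _.
  exact: normal_form_type_A.
have [w lE] := choice (fun i => homog1_linear_form (l_homog i)).
have {}lE : l = (fun i => linear_form (w i)) by apply: funext.
rewrite {}lE in fE n3.
have w_distinct := waring_forms_distinct (ltnW d_gt1) f_rank fE.
have [v [v_triple v_unique]] := unique_multiple_point w_distinct n3.
have [A [s [a1 [b1 [a2 [b2 [c2 [A_unit s_perm neq0 det_neq0 sE]]]]]]]] :=
  normal_coordinates w_distinct v_triple v_unique.
exists A, a1, b1, a2, b2, c2; split=> //.
rewrite fE lin_subst_sum_powers -big_enum -(perm_big _ s_perm) /=.
rewrite -(big_map (fun i => w i *m A) xpredT (fun y => linear_form y ^+ d)) sE.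
exact: sum_powers_normal_form.
Qed.
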